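(* Let $G$ be a Garside group with Garside element $\Delta$, let $g\in G$ and let $a,b,k$ be nonzero integers. (i) If $g^{kb}$ is conjugate to $\Delta^{ka}$, then $g^b$ is conjugate to $\Delta^a$. (ii) If each of $g^a$ and $g^b$ is conjugate to a power of $\Delta$, then so is $g^{a\wedge b}$, where $a\wedge b$ denotes the greatest common divisor of $a$ and $b$.
   Context: Garside groups. In a monoid $M$, an atom is an element $a\neq 1$ such that $a=bc$ implies $b=1$ or $c=1$; $\Vert a\Vert$ is the supremum of the lengths of expressions of $a$ as products of atoms. $M$ is atomic if it is generated by its atoms and $\Vert a\Vert<\infty$ for all $a\in M$. Put $a\le_L b$ if $ac=b$ for some $c\in M$, and $a\le_R b$ if $ca=b$ for some $c\in M$. A Garside monoid is an atomic, left and right cancellative monoid $M$ such that $(M,\le_L)$ and $(M,\le_R)$ are lattices and $M$ contains a Garside element $\Delta$, i.e. an element such that for each $a\in M$, $a\le_L\Delta$ iff $a\le_R\Delta$, and the set $[1,\Delta]=\{a\in M: 1\le_L a\le_L\Delta\}$ is finite and generates $M$. A Garside group $G$ with Garside element $\Delta$ is the group of fractions of a Garside monoid $M$ with Garside element $\Delta$; $M$ is identified with its image in $G$. A power of $\Delta$ means $\Delta^\ell$ with $\ell\in\mathbb Z$. *)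

(* Defs.v *)
From HB Require Import structures.
From mathcomp Require Import all_boot all_algebra.

Set Implicit Arguments.
Unset Strict Implicit.
Unset Printing Implicit Defensive.

Local Open Scope group_scope.

Section MonoidDefs.
Variable M : monoidType.
Implicit Types (a b c x : M) (s : seq M) (S : M -> Prop) (R : M -> M -> Prop).

Definition is_atom a : Prop :=
  a <> 1 /\ (forall b c, a = b * c -> b = 1 \/ c = 1).

Definition generated_by S : Prop :=
  forall a, exists s, (forall x, x \in s -> S x) /\ \prod_(x <- s) x = a.

(* ||a|| < oo, where ||a|| is the supremum of the lengths of the expressions
   of a as a product of atoms: these lengths are bounded. *)
Definition atom_norm_finite a : Prop :=
  exists n : nat, forall s,
    (forall x, x \in s -> is_atom x) -> \prod_(x <- s) x = a -> (size s <= n)%N.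

Definition atomic : Prop := generated_by is_atom /\ forall a, atom_norm_finite a.

Definition left_cancellative : Prop := forall a b c, a * b = a * c -> b = c.
Definition right_cancellative : Prop := forall a b c, b * a = c * a -> b = c.

Definition leL a b : Prop := exists c, a * c = b.
Definition leR a b : Prop := exists c, c * a = b.

Definition is_partial_order R : Prop :=
  [/\ forall a, R a a,
      forall a b, R a b -> R b a -> a = b
    & forall a b c, R a b -> R b c -> R a c].

Definition is_meet R a b m : Prop :=
  [/\ R m a, R m b & forall x, R x a -> R x b -> R x m].

Definition is_join R a b j : Prop :=
  [/\ R a j, R b j & forall x, R a x -> R b x -> R j x].

Definition is_lattice R : Prop :=
  [/\ is_partial_order R,
      forall a b, exists m, is_meet R a b m
    & forall a b, exists j, is_join R a b j].

Definition simple_element (Delta : M) a : Prop := leL 1 a /\ leL a Delta.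

Definition garside_element (Delta : M) : Prop :=
  [/\ forall a, leL a Delta <-> leR a Delta,
      exists s, forall a, simple_element Delta a -> a \in s
    & generated_by (simple_element Delta)].

Definition garside_monoid (Delta : M) : Prop :=
  [/\ atomic, left_cancellative /\ right_cancellative,
      is_lattice leL, is_lattice leR & garside_element Delta].

End MonoidDefs.

(* G is the group of fractions of M, with M identified with its image under
   the embedding iota. *)
Definition group_of_fractions (M : monoidType) (G : groupType)
    (iota : UMagmaMorphism.type M G) : Prop :=
  injective iota /\ forall g : G, exists x y : M, g = iota x / iota y.

Definition expgz (G : groupType) (x : G) (z : int) : G :=
  match z with
  | Posz n => x ^+ n
  | Negz n => x ^- n.+1
  end.

Definition conjugate (G : groupType) (x y : G) : Prop := exists h : G, y = x ^ h.

(* Main.v *)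
Require Import Defs.
From HB Require Import structures.
From mathcomp Require Import all_boot all_order all_algebra.

Set Implicit Arguments.
Unset Strict Implicit.
Unset Printing Implicit Defensive.

Import Order.TTheory GRing.Theory Num.Theory.

(** If [h ^+ k = A ^+ k] with [A] a power of [Delta], then [x |-> h x A^-1] is
    an automorphism of the poset [(G, <=_L)], because conjugation by [Delta]
    preserves [M], and the orbit of [1] under it is finite.  The join of this
    orbit is a fixed point [p], and [h p = p A] says that [h] is conjugate to
    [A]; this is (i).

    For (ii), conjugate powers of a nontrivial [Delta] have equal exponents:
    otherwise some element of [M] would be divisible by all powers of [Delta],
    contradicting atomicity.  Comparing [g ^ (a b)] computed in two ways then
    shows that the exponent of [Delta] attached to [g ^ a] is divisible by
    [a / gcd(a, b)], and (i) applies. *)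

(** * Laws of integer exponents in a group *)

Section IntegerPowers.
Variable G : groupType.
Implicit Types (x y : G) (m n : int).
Local Open Scope group_scope.

Lemma expgz_nat x (n : nat) : expgz x n = x ^+ n. Proof. by []. Qed.

Lemma expgzN x n : expgz x (- n)%R = (expgz x n)^-1.
Proof. by case: n => [[|n]|n] /=; rewrite ?invg1 ?invgK. Qed.

Lemma expgzS x n : expgz x (n + 1)%R = expgz x n * x.
Proof.
case: n => [n|[|n]].
- by rewrite -PoszD addn1 /= expgSr.
- by rewrite /= mulVg.
- have -> : (Negz n.+1 + 1 = Negz n)%R.
    by rewrite !NegzE -[n.+2]addn1 PoszD opprD subrK.
  by rewrite /= [x ^+ n.+2]expgS invgM mulgVK.
Qed.

Lemma expgzD x m n : expgz x (m + n)%R = expgz x m * expgz x n.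
Proof.
have addn_case (k : int) (j : nat) : expgz x (k + j%:Z)%R = expgz x k * x ^+ j.
  elim: j => [|j IHj]; first by rewrite addr0 mulg1.
  by rewrite -[j.+1]addn1 PoszD addrA expgzS IHj -mulgA -expgSr addn1.
case: n => j; first exact: addn_case.
apply: (@mulIg _ (x ^+ j.+1)).
by rewrite -addn_case NegzE subrK expgzN mulgVK.
Qed.

Lemma expgzM x m n : expgz x (m * n)%R = expgz (expgz x m) n.
Proof.
have muln_case (j : nat) : expgz x (m * j%:Z)%R = expgz x m ^+ j.
  elim: j => [|j IHj]; first by rewrite mulr0.
  by rewrite -[j.+1]addn1 PoszD mulrDr mulr1 expgzD IHj addn1 expgSr.
by case: n => j //; rewrite NegzE mulrN !expgzN muln_case.
Qed.

Lemma expgzC x m n : commute (expgz x m) (expgz x n).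
Proof. by rewrite /commute -!expgzD addrC. Qed.

Lemma expgzJ x y n : expgz x n ^ y = expgz (x ^ y) n.
Proof. by case: n => j; rewrite /= ?conjVg conjXg. Qed.

End IntegerPowers.

Section GarsideGroup.
Variables (M : monoidType) (Delta : M) (G : groupType).
Variable iota : UMagmaMorphism.type M G.
Hypothesis hM : garside_monoid Delta.
Hypothesis hG : group_of_fractions iota.
Local Open Scope group_scope.

Local Notation D := (iota Delta).

(** * The left-invariant order on [G] with positive cone [M], and its finite joins *)

Definition positive (x : G) : Prop := exists m : M, x = iota m.
Definition leG (x y : G) : Prop := positive (x^-1 * y).

Lemma positive1 : positive 1.
Proof. by exists 1; rewrite gmulf1. Qed.

Lemma positiveM x y : positive x -> positive y -> positive (x * y).
Proof. by move=> [a ->] [b ->]; exists (a * b); rewrite gmulfM. Qed.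

Lemma positive_antisym x : positive x -> positive x^-1 -> x = 1.
Proof.
move=> [a ->] [b ab1]; have [_ _ [[_ antisymL _] _ _] _ _] := hM.
suff -> : a = 1 by rewrite gmulf1.
apply: antisymL; last by exists a; rewrite mul1g.
exists b; apply: (proj1 hG).
by rewrite gmulfM -ab1 mulgV gmulf1.
Qed.

Lemma leG_refl x : leG x x.
Proof. by rewrite /leG mulVg; exact: positive1. Qed.

Lemma leG_trans x y z : leG x y -> leG y z -> leG x z.
Proof.
move=> xy yz; have := positiveM xy yz.
by rewrite /leG -mulgA mulVKg.
Qed.

Lemma leG_antisym x y : leG x y -> leG y x -> x = y.
Proof.
move=> xy yx; have xy1 : x^-1 * y = 1.
  by apply: positive_antisym => //; rewrite invgM invgK.
by rewrite -(mulVKg x y) xy1 mulg1.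
Qed.

(** A join for [leR] is a common left multiple [a u = b v], which turns [u v^-1] into [a^-1 b]. *)
Lemma left_fraction (x : G) : exists a b : M, x = (iota a)^-1 * iota b.
Proof.
have [u [v ->]] := proj2 hG x.
have [_ _ _ [_ _ joinR] _] := hM.
have [j [[a au] [b bv] _]] := joinR u v.
exists a, b; apply: (@mulgI _ (iota a)); apply: (@mulIg _ (iota v)).
by rewrite mulVKg -mulgA mulgVK -!gmulfM au bv.
Qed.

(** Left translation by a suitable [q] carries a pair [a], [b] of [M] to [x], [y]. For an upper
    bound [z], the element [q^-1 z] lies above [a], hence in [M], so the join taken in [M] remains
    least in [G]. *)
Lemma leG_join x y :
  exists j, [/\ leG x j, leG y j & forall z, leG x z -> leG y z -> leG j z].
Proof.
have [a [b xyE]] := left_fraction (x^-1 * y).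
have [_ _ [_ _ joinL] _ _] := hM.
have [m [[a' am] [b' bm] m_min]] := joinL a b.
have [q xE] : exists q, x = q * iota a by exists (x / iota a); rewrite mulgVK.
have yE : y = q * iota b by rewrite -(mulVKg x y) xyE {1}xE -mulgA mulVKg.
exists (q * iota m); split.
- by exists a'; rewrite xE invgM -mulgA mulKg -am gmulfM mulKg.
- by exists b'; rewrite yE invgM -mulgA mulKg -bm gmulfM mulKg.
move=> z [u uE] [v vE].
have zu : q^-1 * z = iota (a * u) by rewrite gmulfM -uE xE invgM -mulgA mulVKg.
have zv : q^-1 * z = iota (b * v) by rewrite gmulfM -vE yE invgM -mulgA mulVKg.
have [w wE] : leL m (a * u).
  apply: m_min; first by exists u.
  by exists v; apply: (proj1 hG); rewrite -zu -zv.
by exists w; rewrite invgM -mulgA zu -wE gmulfM mulKg.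
Qed.

Lemma leG_joins (f : nat -> G) n :
  exists j, (forall i, i <= n -> leG (f i) j) /\
    forall z, (forall i, i <= n -> leG (f i) z) -> leG j z.
Proof.
elim: n => [|n [j [j_ub j_min]]].
  exists (f 0); split=> [i|z]; last exact.
  by rewrite leqn0 => /eqP->; exact: leG_refl.
have [j' [jj' fj' j'_min]] := leG_join j (f n.+1).
exists j'; split=> [i|z z_ub].
  rewrite leq_eqVlt => /predU1P[-> //|lt_in].
  by apply: leG_trans jj'; apply: j_ub.
by apply: j'_min; [apply: j_min => i le_in; apply: z_ub; exact: leqW | exact: z_ub].
Qed.

(** * Conjugation by powers of [Delta] preserves [M] *)

Lemma mul_Delta (x : M) : exists y, x * Delta = Delta * y.
Proof.
have [_ _ _ _ [sideP _ gen]] := hM.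
have [s [s_simple <-]] := gen x.
elim: s s_simple => [_|a s IHs as_simple].
  by exists 1; rewrite big_nil mul1g mulg1.
have [y yE] : exists y, \prod_(z <- s) z * Delta = Delta * y.
  by apply: IHs => z zs; apply: as_simple; rewrite inE zs orbT.
(* From [a b = Delta], [b] divides [Delta] on the right, hence also on the left: [b c = Delta]. Thus
   [a Delta = a b c = Delta c]. *)
have [_ [b ab]] : simple_element Delta a by apply: as_simple; rewrite mem_head.
have [c bc] : leL b Delta by apply/sideP; exists a.
by exists (c * y); rewrite big_cons -mulgA yE !mulgA -{1}bc mulgA ab.
Qed.

Lemma Delta_mul (x : M) : exists y, Delta * x = y * Delta.
Proof.
have [_ _ _ _ [sideP _ gen]] := hM.
have [s [s_simple <-]] := gen x.
elim: s s_simple => [_|a s IHs as_simple].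
  by exists 1; rewrite big_nil mul1g mulg1.
have [y yE] : exists y, Delta * \prod_(z <- s) z = y * Delta.
  by apply: IHs => z zs; apply: as_simple; rewrite inE zs orbT.
have [_ aD] : simple_element Delta a by apply: as_simple; rewrite mem_head.
have [b ba] : leR a Delta by apply/sideP.
have [c cb] : leR b Delta by apply/sideP; exists a.
exists (c * y); rewrite big_cons mulgA -{1}cb -(mulgA c) ba.
by rewrite -mulgA yE mulgA.
Qed.

Lemma positiveJ x n : positive x -> positive (x ^ expgz D n).
Proof.
have natJ y (j : nat) : positive y -> positive (y ^ (D ^+ j)).
  move=> y_pos; elim: j => [|j [m mE]]; first by rewrite conjg1.
  have [m' m'E] := mul_Delta m.
  exists m'; rewrite expgSr conjgM mE conjgE.
  by rewrite -gmulfM m'E gmulfM mulKg.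
have natVJ y (j : nat) : positive y -> positive (y ^ (D ^- j)).
  move=> y_pos; elim: j => [|j [m mE]]; first by rewrite invg1 conjg1.
  have [m' m'E] := Delta_mul m.
  exists m'; rewrite expgS invgM conjgM mE conjgE invgK.
  by rewrite mulgA -gmulfM m'E gmulfM mulgK.
by case: n => j x_pos; [exact: natJ | exact: (natVJ x j.+1)].
Qed.

(** * Extracting roots by a fixed point *)

Lemma conjugate_of_eq_power (h : G) (n : int) k :
  h ^+ k.+1 = expgz D n ^+ k.+1 -> exists p, h ^ p = expgz D n.
Proof.
set A := expgz D n => hkA.
(* [f] runs through the orbit of [1] under [phi : x |-> h x A^-1]. *)
pose f i := h ^+ i * A ^- i.
have fS i : f i.+1 = h * f i * A^-1 by rewrite /f !expgS invgM !mulgA.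
have fk : f k.+1 = f 0 by rewrite /f hkA mulgV invg1 mulg1.
(* Left multiplication by [h] leaves [x^-1 y] unchanged, and right multiplication by [A^-1] only
   conjugates it by a power of [D]. *)
have phi_le x y : leG x y -> leG (h * x * A^-1) (h * y * A^-1).
  rewrite /leG -[A]invgK => xy.
  have := @positiveJ _ (- n)%R xy; rewrite expgzN -/A conjgE invgK.
  by rewrite !invgM !invgK !mulgA mulgVK.
have phiK_le x y : leG (h * x * A^-1) (h * y * A^-1) -> leG x y.
  rewrite /leG => /(@positiveJ _ n); rewrite -/A conjgE.
  by rewrite !invgM !invgK !mulgA mulVg mul1g !mulgVK.
have [p [p_ub p_min]] := leG_joins f k.
have p_phi : leG p (h * p * A^-1).
  apply: p_min => -[_|i le_ik]; last by rewrite fS; apply/phi_le/p_ub/ltnW.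
  by rewrite -fk fS; apply/phi_le/p_ub.
have phi_p : leG (h * p * A^-1) p.
  (* [r] is the preimage of [p] under [phi]. It is again an upper bound of the orbit, so [p] is
     below [r]; applying [phi] gives the claim. *)
  pose r := h^-1 * p * A.
  have rE : h * r * A^-1 = p by rewrite /r -mulgA mulgK mulVKg.
  rewrite -[X in leG _ X]rE; apply: phi_le.
  apply: p_min => i le_ik; apply: phiK_le; rewrite rE -fS.
  move: le_ik; rewrite leq_eqVlt => /predU1P[->|]; last exact: p_ub.
  by rewrite fk; exact: p_ub.
exists p; have pE := leG_antisym p_phi phi_p.
by rewrite conjgE -[h * p](mulgVK A) -pE mulKg.
Qed.

Lemma conjugate_root (g : G) (a b k : int) : k <> 0%R ->
  conjugate (expgz g (k * b)%R) (expgz D (k * a)%R) ->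
  conjugate (expgz g b) (expgz D a).
Proof.
rewrite ![(k * _)%R]mulrC !expgzM => k0 [c /esym cE].
(* [j.+1] is the absolute value of [k]; for negative [k] both sides are inverted. *)
have [j jE] : exists j, (expgz g b ^ c) ^+ j.+1 = expgz D a ^+ j.+1.
  move: cE; rewrite expgzJ; case: k k0 => [[|j]|j] //= _; first by exists j.
  by move/invg_inj; exists j.
have [p pE] := conjugate_of_eq_power jE.
by exists (c * p); rewrite conjgM.
Qed.

(** * Exponents of conjugate powers of [Delta] *)

Lemma left_fraction_Delta (h : G) : exists n p, h = D ^- n * iota p.
Proof.
have [u [v ->]] := proj2 hG h.
(* Each simple factor of [v] costs one [Delta]: [a^-1 Delta = b] is positive, and moving [b] past
   [D ^+ n] conjugates it within [M]. *)
have [n vn] : exists n, positive ((iota v)^-1 * D ^+ n).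
  have [_ _ _ _ [_ _ gen]] := hM.
  have [s [s_simple <-]] := gen v.
  elim: s s_simple => [_|a s IHs as_simple].
    by exists 0; rewrite big_nil gmulf1 invg1 mulg1; exact: positive1.
  have [n n_pos] : exists n, positive ((iota (\prod_(z <- s) z))^-1 * D ^+ n).
    by apply: IHs => z zs; apply: as_simple; rewrite inE zs orbT.
  have [_ [b ab]] : simple_element Delta a by apply: as_simple; rewrite mem_head.
  have b_pos : positive (iota b ^ D ^+ n).
    by apply: (@positiveJ _ n); exists b.
  exists n.+1; have := positiveM n_pos b_pos; congr positive.
  rewrite big_cons gmulfM invgM -!mulgA; congr (_ * _).
  by rewrite conjgE mulVKg expgS -{2}ab gmulfM -mulgA mulKg.
have u_pos : positive (iota u) by exists u.
have [p pE] := @positiveJ _ (- Posz n)%R (positiveM u_pos vn).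
exists n, p; rewrite -pE expgzN /= conjgE invgK.
by rewrite mulKg !mulgA mulgK.
Qed.

(** A nontrivial [Delta] is a nonempty product of atoms, so divisibility by [Delta ^+ n.+1] forces
    an expression of [p] with more than [n] atoms, where [n] bounds their number. *)
Lemma Delta_power_bounded (p : M) : Delta <> 1 ->
  (forall n, exists q, p = q * Delta ^+ n) -> False.
Proof.
move=> D1 p_div; have [[atoms bounded] _ _ _ _] := hM.
have [n n_max] := bounded p.
have [d [d_atom dE]] := atoms Delta.
have [q pE] := p_div n.+1; have [s [s_atom sE]] := atoms q.
have d_gt0 : 0 < size d.
  by case: d dE {d_atom} => // /esym; rewrite big_nil.
have [t [t_atom tE t_size]] : exists t, [/\ forall x, x \in t -> is_atom x,
    \prod_(x <- t) x = Delta ^+ n.+1 & n.+1 <= size t].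
  elim: n.+1 => [|j [t [t_atom tE t_size]]].
    by exists [::]; split; rewrite ?big_nil.
  exists (d ++ t); split.
  - by move=> x; rewrite mem_cat => /orP[/d_atom|/t_atom].
  - by rewrite big_cat dE tE expgS.
  - by rewrite size_cat -[j.+1]add1n leq_add.
have /n_max : forall x, x \in s ++ t -> is_atom x.
  by move=> x; rewrite mem_cat => /orP[/s_atom|/t_atom].
rewrite big_cat sE tE => /(_ (esym pE)).
by rewrite size_cat leqNgt (leq_trans t_size) ?leq_addl.
Qed.

Lemma conjugate_Delta_ge (m n : int) : Delta <> 1 ->
  conjugate (expgz D m) (expgz D n) -> (n <= m)%R.
Proof.
move=> D1 [h hE]; rewrite leNgt; apply/negP => lt_mn.
have [j nE] : exists j : nat, n = (m + j.+1%:Z)%R.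
  exists (absz (n - m)%R).-1; rewrite prednK; last first.
    by rewrite absz_gt0 subr_eq0 gt_eqF.
  rewrite gez0_abs; first by rewrite addrC subrK.
  by rewrite subr_ge0 ltW.
have [c [p pE]] := left_fraction_Delta h.
(* Powers of [D] commute, so the factor [D ^- c] of the conjugator [h] drops out and the positive
   [p] conjugates as well. *)
have {}hE : expgz D m * iota p = iota p * expgz D n.
  apply: (@mulgI _ (D ^- c)); rewrite !mulgA -pE hE mulVKg pE mulgA.
  by have := expgzC D (- Posz c)%R m; rewrite expgzN => ->.
apply: (@Delta_power_bounded p D1) => i.
have powE : expgz D m ^+ i * iota p = iota p * expgz D n ^+ i.
  elim: i => [|i IHi]; first by rewrite mul1g mulg1.
  by rewrite expgSr -mulgA hE mulgA IHi -mulgA -expgSr.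
have [q qE] : positive (iota p ^ (expgz D m ^+ i)).
  by rewrite -expgz_nat -expgzM; apply: positiveJ; exists p.
(* With [q] the conjugate of [p] by [D ^ (m i)], [powE] reads [p = q D ^ ((n - m) i)], and
   [n - m = j + 1] leaves a final factor [Delta ^+ i]. *)
exists (q * Delta ^+ (j * i)); apply: (proj1 hG).
rewrite !gmulfM !gmulfXn -qE conjgE -!mulgA -expgnDr -mulSnr.
have -> : expgz D m ^+ i * D ^+ (j.+1 * i) = expgz D n ^+ i.
  by rewrite nE expgzD expgMn ?expgnA; last exact: expgzC.
by rewrite -powE mulKg.
Qed.

(** * Conjugacy of powers, and the greatest common divisor *)

Lemma expgz_1 n : expgz (1 : G) n = 1.
Proof. by case: n => j; rewrite /= expg1n ?invg1. Qed.

Lemma conjugate_expgz (x y : G) n :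
  conjugate x y -> conjugate (expgz x n) (expgz y n).
Proof. by move=> [h ->]; exists h; rewrite expgzJ. Qed.

Lemma conjugate_sym (x y : G) : conjugate x y -> conjugate y x.
Proof. by move=> [h ->]; exists h^-1; rewrite conjgK. Qed.

Lemma conjugate_trans (x y z : G) :
  conjugate x y -> conjugate y z -> conjugate x z.
Proof. by move=> [h ->] [k ->]; exists (h * k); rewrite conjgM. Qed.

Lemma conjugate_Delta_eq (m n : int) : Delta <> 1 ->
  conjugate (expgz D m) (expgz D n) -> m = n.
Proof.
move=> D1 mn; apply: le_anti.
by rewrite !conjugate_Delta_ge //; exact: conjugate_sym.
Qed.

Lemma conjugate_gcd (g : G) (a b l m : int) : a <> 0%R -> b <> 0%R ->
  conjugate (expgz g a) (expgz D l) ->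
  conjugate (expgz g b) (expgz D m) ->
  exists l', conjugate (expgz g (gcdz a b)) (expgz D l').
Proof.
move=> a0 b0 gal gbm.
have /dvdzP[k aE] := dvdz_gcdl a b; have /dvdzP[k' bE] := dvdz_gcdr a b.
set d := gcdz a b in aE bE *.
have k0 : k <> 0%R by move=> k0; apply: a0; rewrite aE k0 mul0r.
suff [l' lE] : exists l', expgz D l = expgz D (k * l')%R.
  by exists l'; apply: (conjugate_root k0); rewrite -aE -lE.
(* If [Delta = 1], exponents are not determined by conjugacy, but all powers of [D] coincide and any
   [l'] serves. *)
have [D1|/eqP D1] := eqVneq Delta 1.
  by exists 0%R; rewrite D1 gmulf1 !expgz_1.
have d0 : d != 0%R by apply/eqP => d0; apply: a0; rewrite aE d0 mulr0.
(* Both [D ^ (l b)] and [D ^ (m a)] are conjugate to [g ^ (a b)]. *)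
have lbma : (l * b)%R = (m * a)%R.
  apply: conjugate_Delta_eq => //; rewrite !expgzM.
  apply: (@conjugate_trans _ (expgz g (a * b)%R)).
    by apply: conjugate_sym; rewrite expgzM; exact: conjugate_expgz.
  by rewrite mulrC expgzM; exact: conjugate_expgz.
have lkmk : (l * k')%R = (m * k)%R.
  by apply: (mulIf d0); rewrite -!mulrA -aE -bE.
have kk' : coprimez k k'.
  have : (gcdz k k' * `|d|%:Z == 1 * d)%R.
    by rewrite mulz_gcdl -aE -bE mul1r.
  by rewrite gez0_abs // (inj_eq (mulIf d0)).
(* [k] divides [l k' = m k] and is coprime to [k']. *)
have /dvdzP[l' lE] : (k %| l)%Z.
  by rewrite -(Gauss_dvdzl _ kk') lkmk dvdz_mull.
by exists l'; rewrite lE mulrC.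
Qed.

End GarsideGroup.

Theorem theorem3p9 (M : monoidType) (Delta : M) (G : groupType)
    (iota : UMagmaMorphism.type M G)
    (hM : garside_monoid Delta) (hG : group_of_fractions iota)
    (g : G) (a b k : int)
    (ha : a <> 0%R) (hb : b <> 0%R) (hk : k <> 0%R) :
  (conjugate (expgz g (k * b)%R) (expgz (iota Delta) (k * a)%R) ->
     conjugate (expgz g b) (expgz (iota Delta) a)) /\
  ((exists l : int, conjugate (expgz g a) (expgz (iota Delta) l)) ->
   (exists l : int, conjugate (expgz g b) (expgz (iota Delta) l)) ->
   exists l : int, conjugate (expgz g (gcdz a b)) (expgz (iota Delta) l)).
Proof.
split; first exact: (conjugate_root hM hG).
by move=> [l gal] [m gbm]; exact: (conjugate_gcd hM hG ha hb gal gbm).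
Qed.
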